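(* Let $\Theta$ be a rectangular subspace of $\mathbb{R}^p$. Let $\phi=(\phi_1,\ldots,\phi_p):\Theta\to\mathbb{R}^p$ be a differentiable vector-valued function, and assume that the order of integration and differentiation in $\phi$ can be interchanged, i.e. $\int(\partial\phi(\theta)/\partial\theta)\,d\theta=\partial\left(\int\phi(\theta)\,d\theta\right)/\partial\theta$ holds. Suppose that $$\frac{\partial\phi_t(\theta)}{\partial\theta_u}=\frac{\partial\phi_u(\theta)}{\partial\theta_t}\quad(t,u=1,\ldots,p).$$ Fix an arbitrary constant vector $(c_1,\ldots,c_p)\in\Theta$, define $\psi_t(\theta_t,\ldots,\theta_p)=\phi_t(c_1,\ldots,c_{t-1},\theta_t,\ldots,\theta_p)$ for $t=1,\ldots,p$, and let $$\tilde\pi(\theta)=\exp\left\{\sum_{t=1}^p\int_{c_t}^{\theta_t}\psi_t(z,\theta_{t+1},\ldots,\theta_p)\,dz\right\}.$$ Then any prior $\pi(\theta)\propto\tilde\pi(\theta)$ satisfies $$\frac{\partial\log\pi(\theta)}{\partial\theta}=\phi(\theta).$$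
   Context: A prior $\pi$ is a positive function on $\Theta$ determined up to a positive multiplicative constant; it may be improper (its integral over $\Theta$ may be infinite). The interchange assumption means that derivatives of $\phi$ with respect to one coordinate may be taken under the integral sign for integrals of $\phi$ over other coordinates. *)

(* Defs.v *)
From HB Require Import structures.
From mathcomp Require Import all_boot all_order all_algebra.
From mathcomp Require Import all_classical all_reals all_analysis.

Set Implicit Arguments.
Unset Strict Implicit.
Unset Printing Implicit Defensive.

Import Order.TTheory GRing.Theory Num.Theory.
Import numFieldNormedType.Exports.

Local Open Scope classical_set_scope.
Local Open Scope ring_scope.

Section Defs.
Context {R : realType} {p : nat}.
Implicit Types (Theta : set 'rV[R]_p) (x c theta : 'rV[R]_p).

(* The sides may be open, closed, half-open or unbounded, see [interval]. *)
Definition rectangle (I : 'I_p -> interval R) : set 'rV[R]_p :=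
  [set theta | forall i, theta 0 i \in I i].

(* Excludes empty sides and sides reduced to a point, along which no
   derivative could be taken. *)
Definition nondegenerate_sides (I : 'I_p -> interval R) : Prop :=
  forall i, exists a b, [/\ a \in I i, b \in I i & a < b].

(* Increments are restricted to those staying in [Theta], so that at a boundary
   point of [Theta] the derivative is one-sided; at an interior point it is
   the library's derivative along ['e_u]; see [is_partial_interior]. *)
Definition partial_quotient_filter Theta (u : 'I_p) x : set_system R :=
  within [set h | Theta (x + h *: 'e_u)] 0^'.

Definition is_partial Theta (u : 'I_p) (f : 'rV[R]_p -> R) x (l : R) : Prop :=
  h^-1 * (f (x + h *: 'e_u) - f x)
    @[h --> partial_quotient_filter Theta u x] --> l.

Definition partial Theta (u : 'I_p) (f : 'rV[R]_p -> R) x : R :=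
  lim (h^-1 * (f (x + h *: 'e_u) - f x)
         @[h --> partial_quotient_filter Theta u x]).

Definition set_coord (t : 'I_p) (z : R) theta : 'rV[R]_p :=
  \row_j (if j == t then z else theta 0 j).

(* Only one coordinate [t] is integrated out at a time, over the compact
   subintervals of its range. *)
Definition integral_partial_interchange (I : 'I_p -> interval R)
    (phi : 'rV[R]_p -> 'rV[R]_p) : Prop :=
  forall (s t u : 'I_p), t != u ->
  forall theta, rectangle I theta ->
  forall a b : R, a \in I t -> b \in I t -> a <= b ->
    let dphi z :=
      partial (rectangle I) u (fun y => phi y 0 s) (set_coord t z theta) in
    lebesgue_measure.-integrable `[a, b] (EFin \o dphi) /\
    is_partial (rectangle I) u
      (fun y => \int[lebesgue_measure]_(z in `[a, b]) phi (set_coord t z y) 0 s)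
      theta
      (\int[lebesgue_measure]_(z in `[a, b]) dphi z).

Definition oriented_integral (f : R -> R) (a b : R) : R :=
  if a <= b then \int[lebesgue_measure]_(z in `[a, b]) f z
  else - \int[lebesgue_measure]_(z in `[b, a]) f z.

(* Encoded as a function of the whole vector [theta] that ignores the
   coordinates before [t]. *)
Definition psi (phi : 'rV[R]_p -> 'rV[R]_p) c (t : 'I_p) theta : R :=
  phi (\row_j (if (j < t)%N then c 0 j else theta 0 j)) 0 t.

Definition pi_tilde (phi : 'rV[R]_p -> 'rV[R]_p) c theta : R :=
  expR (\sum_(t < p)
    oriented_integral (fun z => psi phi c t (set_coord t z theta))
      (c 0 t) (theta 0 t)).

(* Possibly improper: no integrability is required. *)
Definition prior Theta (pi : 'rV[R]_p -> R) : Prop :=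
  forall theta, Theta theta -> 0 < pi theta.

Definition proportional_on Theta (f g : 'rV[R]_p -> R) : Prop :=
  exists2 k : R, 0 < k & forall theta, Theta theta -> f theta = k * g theta.

Lemma is_partial_interior Theta u (f : 'rV[R]_p -> R) x (l : R) :
  nbhs x Theta ->
  is_partial Theta u f x l <-> is_derive x 'e_u f l.
Proof.
move=> Tx; rewrite /is_partial /partial_quotient_filter.
have cx : (fun h : R => x + h *: ('e_u : 'rV[R]_p)) h @[h --> 0^'] --> x.
  rewrite -[X in _ --> X]addr0 -(scale0r ('e_u : 'rV[R]_p)).
  apply: cvgD; first exact: cvg_cst.
  by apply: cvgZr_tmp; apply: cvg_within.
have -> : within [set h | Theta (x + h *: 'e_u)] 0^' = 0^' :> set_system R.
  rewrite eqEsubset; split=> P; last first.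
    by move=> P0; apply: filterS P0 => h Ph _.
  rewrite /within /= => P0.
  have T0 : \forall h \near (0 : R)^', Theta (x + h *: 'e_u) by exact: cx _ Tx.
  by near=> h; apply: (near P0 h) => //; near: h.
have -> : (fun h : R => h^-1 * (f (x + h *: 'e_u) - f x)) =
          (fun h => h^-1 *: ((f \o shift x) (h *: 'e_u) - f x)).
  by apply/funext => h; rewrite /= [x + _]addrC.
split=> [fl|fl].
  apply: DeriveDef; first by apply/cvg_ex; exists l.
  exact/cvg_lim.
have /cvg_ex[l' l'P] := @ex_derive _ _ _ _ _ _ _ fl.
have <- := @derive_val _ _ _ _ _ _ _ fl.
by rewrite /derive; apply/cvg_ex; exists l'.
Unshelve. all: by end_near. Qed.

End Defs.

(* Main.v *)
(* Goursat's argument shows that the integral of the 1-form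
   phi_t dx_t + phi_u dx_u around every rectangle parallel to a coordinate plane
   vanishes: pointwise differentiability and the symmetry of the derivatives
   suffice, by repeated bisection into quarters.  Moving theta along e_u thus
   changes the t-th summand of log pi_tilde, for t < u, by the difference of two
   integrals of phi_u along edges parallel to e_u, which differ only in whether
   the t-th coordinate is theta_t or c_t.  The sum over t telescopes to the
   integral of phi_u along the segment from theta to theta + h e_u, and phi_u is
   continuous there. *)
Require Import Defs.
From mathcomp Require Import all_boot all_order all_algebra.
From mathcomp Require Import all_classical all_reals all_analysis.
From mathcomp Require Import lra ring.
Import Order.TTheory GRing.Theory Num.Theory.
Import numFieldNormedType.Exports.
Local Open Scope classical_set_scope.
Local Open Scope ring_scope.

(** * Oriented integrals of functions continuous on an interval *)

Section OrientedIntegral.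
Context {R : realType} (I : interval R).
Implicit Types (f g : R -> R) (a b c : R).
Local Notation mu := (@lebesgue_measure R).

Lemma subset_itvcc a b : a \in I -> b \in I -> `[a, b] `<=` [set` I].
Proof.
move=> aI bI z /=; rewrite in_itv /= => /andP[az zb].
by apply: (@interval_is_interval _ I a b) => //; rewrite az.
Qed.

Lemma continuous_integrable_itvcc f a b : {within [set` I], continuous f} ->
  a \in I -> b \in I -> mu.-integrable `[a, b] (EFin \o f).
Proof.
move=> cf aI bI; apply: continuous_compact_integrable.
  exact: segment_compact.
exact: continuous_subspaceW (subset_itvcc _ _ aI bI) cf.
Qed.

Lemma oriented_integralN f a b : oriented_integral f b a = - oriented_integral f a b.
Proof.
rewrite /oriented_integral; case: (ltgtP a b) => ab; rewrite ?opprK //.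
by rewrite ab set_itv1 Rintegral_set1 oppr0.
Qed.

(** For [a <= b <= c] this is additivity of the Lebesgue integral; every other order of the points
    follows by sign changes. *)
Lemma oriented_integralD f a b c : {within [set` I], continuous f} ->
  a \in I -> b \in I -> c \in I ->
  oriented_integral f a b + oriented_integral f b c = oriented_integral f a c.
Proof.
move=> cf.
have sorted x y z : x \in I -> y \in I -> z \in I -> x <= y -> y <= z ->
    oriented_integral f x y + oriented_integral f y z = oriented_integral f x z.
  move=> xI yI zI xy yz.
  rewrite /oriented_integral xy yz (le_trans xy yz).
  have fxz := continuous_integrable_itvcc _ _ _ cf xI zI.
  have fyz := continuous_integrable_itvcc _ _ _ cf yI zI.
  apply/eqP; rewrite addrC eq_sym -subr_eq; apply/eqP.
  rewrite Rintegral_itvB ?bnd_simp // Rintegral_itv_obnd_cbnd //.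
  apply: integrableS fyz => //.
  by apply: subset_itvr; rewrite bnd_simp.
move=> aI bI cI.
have := sorted; have [ab|/ltW ba] := leP a b; have [bc|/ltW cb] := leP b c.
- by move=> /(_ a b c); apply.
- have [ac|/ltW ca] := leP a c.
  + move=> /(_ a c b aI cI bI ac cb) <-.
    by rewrite (oriented_integralN f c b) addrK.
  + move=> /(_ c a b cI aI bI ca ab) /eqP.
    rewrite (oriented_integralN f b c) (oriented_integralN f a c).
    by move=> /eqP; lra.
- have [ac|/ltW ca] := leP a c.
  + move=> /(_ b a c bI aI cI ba ac) <-.
    by rewrite (oriented_integralN f a b) addNKr.
  + move=> /(_ b c a bI cI aI bc ca).
    rewrite (oriented_integralN f a b) (oriented_integralN f a c).
    by lra.
- move=> /(_ c b a cI bI aI cb ba).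
  rewrite (oriented_integralN f a b) (oriented_integralN f b c).
  by rewrite (oriented_integralN f a c); lra.
Qed.

(** Serves for two opposite edges of a rectangle and, with [g = 0], for differentiating an integral
    at its endpoint. The two bounds on [z] say that it lies between [a] and [b], whatever their
    order. *)
Lemma oriented_integralB_bound f g a b (k e : R) :
  {within [set` I], continuous f} -> {within [set` I], continuous g} ->
  a \in I -> b \in I ->
  (forall z, z \in I -> `|z - a| <= `|b - a| -> `|z - b| <= `|b - a| ->
     `|f z - g z - k| <= e) ->
  `|oriented_integral f a b - oriented_integral g a b - k * (b - a)|
    <= e * `|b - a|.
Proof.
move=> cf cg aI bI fgk.
have sorted x y : x \in I -> y \in I -> x <= y ->
    (forall z, z \in I -> x <= z <= y -> `|f z - g z - k| <= e) ->
    `|oriented_integral f x y - oriented_integral g x y - k * (y - x)|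
       <= e * (y - x).
  move=> xI yI xy H.
  have fxy := continuous_integrable_itvcc _ _ _ cf xI yI.
  have gxy := continuous_integrable_itvcc _ _ _ cg xI yI.
  have mul : fine (mu `[x, y]) = y - x.
    rewrite lebesgue_measure_itv /= lte_fin; case: ltgtP xy => //= -> _.
    by rewrite subrr.
  have intk r : mu.-integrable `[x, y] (EFin \o cst r).
    by apply: (continuous_compact_integrable) => //;
      [exact: segment_compact | exact: continuous_subspaceT (@cst_continuous _ _ _)].
  have cstE r : r * (y - x) = \int[mu]_(z in `[x, y]) (cst r z).
    by rewrite Rintegral_cst // mul.
  have fgxy : mu.-integrable `[x, y] (EFin \o (fun z => f z - g z)).
    by have := integrableB _ fxy gxy; rewrite compE /=; apply.
  have fgkxy : mu.-integrable `[x, y] (EFin \o (fun z => f z - g z - k)).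
    by have := integrableB _ fgxy (intk k); rewrite compE /=; apply.
  rewrite /oriented_integral xy !cstE -!RintegralB //.
  apply: (le_trans (le_normr_Rintegral _ _)) => //.
  apply: le_Rintegral => //; first exact: integrable_norm.
  move=> z zxy; apply: H; last by move: zxy; rewrite /= in_itv.
  exact: subset_itvcc xI yI _ zxy.
have [ab|/ltW ba] := leP a b.
  rewrite [`|b - a|]ger0_norm ?subr_ge0 //; apply: sorted => // z zI /andP[az zb].
  by apply: fgk => //; rewrite [`|b - a|]ger0_norm ?subr_ge0 // ler_norml; lra.
rewrite (oriented_integralN f b a) (oriented_integralN g b a).
rewrite [`|b - a|]ler0_norm ?subr_le0 // opprB -normrN [X in `|X|](_ : _ =
  oriented_integral f b a - oriented_integral g b a - k * (a - b)); last by ring.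
apply: sorted => // z zI /andP[az zb].
by apply: fgk => //; rewrite [`|b - a|]ler0_norm ?subr_le0 // ler_norml; lra.
Qed.

End OrientedIntegral.

(** * Bisection of rectangles *)

Section Bisection.
Context {R : realType}.

(** The supremum of the left endpoints works: comparison at a common later index shows that each
    right endpoint bounds all left endpoints. *)
Lemma nested_intervals_point (x l : nat -> R) :
  (forall n, 0 <= l n) -> (forall n, x n <= x n.+1) ->
  (forall n, x n.+1 + l n.+1 <= x n + l n) ->
  exists x0, forall n, x n <= x0 <= x n + l n.
Proof.
move=> l0 xS xlS.
have xle : {homo x : n m / (n <= m)%N >-> n <= m}.
  exact: (homo_leq (@lexx _ _) (@le_trans _ _)).
have xlle : {homo (fun n => x n + l n) : n m / (n <= m)%N >-> m <= n}.
  by apply: homo_leq => // y z t /[swap]; exact: le_trans.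
have xub n m : x n <= x m + l m.
  apply: (le_trans (xle _ _ (leq_maxl n m))).
  apply: le_trans (xlle _ _ (leq_maxr n m)).
  by rewrite lerDl.
exists (sup (range x)) => n; apply/andP; split.
  apply: ub_le_sup; last by exists n.
  by exists (x n + l n) => _ [m _ <-].
by apply: ge_sup; [exists (x 0%N), 0%N | move=> _ [m _ <-]].
Qed.

Lemma half_half (v : R) n : v / 2 ^+ n = v / 2 ^+ n.+1 + v / 2 ^+ n.+1.
Proof. by rewrite exprS; field; rewrite expf_neq0. Qed.

Lemma halving_intervals_point (w : R) (x : nat -> R) : 0 <= w ->
  (forall n, x n.+1 = x n \/ x n.+1 = x n + w / 2 ^+ n.+1) ->
  exists x0, forall n, x n <= x0 <= x n + w / 2 ^+ n.
Proof.
move=> w0 xS.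
have wn0 n : 0 <= w / 2 ^+ n by rewrite divr_ge0 // exprn_ge0.
apply: nested_intervals_point => // n; have := wn0 n.+1.
  by case: (xS n) => ->; lra.
by rewrite (half_half w n); case: (xS n) => ->; lra.
Qed.

(** [P x y n] speaks of the rectangle with lower left corner [(x, y)] and sides [w / 2 ^+ n] and
    [h / 2 ^+ n]. If [P] failed at the start, it would fail for some quarter at every stage; these
    nested quarters share a point, where the local hypothesis gives a contradiction. *)
Lemma rectangle_bisection (P : R -> R -> nat -> Prop) (a b w h : R) :
  0 <= w -> 0 <= h ->
  (forall x y n, P x y n.+1 -> P (x + w / 2 ^+ n.+1) y n.+1 ->
     P x (y + h / 2 ^+ n.+1) n.+1 ->
     P (x + w / 2 ^+ n.+1) (y + h / 2 ^+ n.+1) n.+1 -> P x y n) ->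
  (forall x0 y0, a <= x0 <= a + w -> b <= y0 <= b + h ->
     exists n, forall x y, x <= x0 <= x + w / 2 ^+ n ->
       y <= y0 <= y + h / 2 ^+ n -> P x y n) ->
  P a b 0%N.
Proof.
move=> w0 h0 Pstep Ploc; apply: contrapT => nP.
(* The choice covers every corner and stage but promises something only where [P] fails, so that
   [next] is a total function. *)
have /choice[next nextP] : forall q : R * R * nat, exists r : R * R,
    ~ P q.1.1 q.1.2 q.2 ->
    [/\ ~ P r.1 r.2 q.2.+1,
        r.1 = q.1.1 \/ r.1 = q.1.1 + w / 2 ^+ q.2.+1 &
        r.2 = q.1.2 \/ r.2 = q.1.2 + h / 2 ^+ q.2.+1].
  move=> [[x y] n] /=.
  have [Pn|nPn] := pselect (P x y n); first by exists (x, y).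
  apply: contrapT => nex; apply: nPn; apply: Pstep; apply: contrapT => nPq.
  - by apply: nex; exists (x, y) => _; split => //; left.
  - by apply: nex; exists (x + w / 2 ^+ n.+1, y) => _; split => //; [right|left].
  - by apply: nex; exists (x, y + h / 2 ^+ n.+1) => _; split => //; [left|right].
  - apply: nex; exists (x + w / 2 ^+ n.+1, y + h / 2 ^+ n.+1) => _.
    by split => //; right.
pose s := fix s n := if n is m.+1 then next (s m, m) else (a, b).
have nPs n : ~ P (s n).1 (s n).2 n.
  by elim: n => //= n /(nextP (s n, n)) [].
have [x0 x0P] : exists x0, forall n, (s n).1 <= x0 <= (s n).1 + w / 2 ^+ n.
  by apply: halving_intervals_point => // n; have [] := nextP (s n, n) (nPs n).
have [y0 y0P] : exists y0, forall n, (s n).2 <= y0 <= (s n).2 + h / 2 ^+ n.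
  by apply: halving_intervals_point => // n; have [] := nextP (s n, n) (nPs n).
have := x0P 0%N; have := y0P 0%N; rewrite /= expr0 !divr1 => y0ab x0ab.
have [n Pn] := Ploc _ _ x0ab y0ab.
by apply: (nPs n); apply: Pn.
Qed.

End Bisection.

(** * Differentiability in two variables on a product of intervals *)

Section AffineApproximation.
Context {R : realType} (I J : interval R).
Implicit Types (f g : R -> R -> R).

(** Total differentiability at [(x0, y0)] relative to the product of [I] and [J], with gradient
    [(A, B)]; one-sided at boundary points. *)
Definition affine_approx f (x0 y0 A B : R) : Prop :=
  forall e : R, 0 < e -> exists2 d : R, 0 < d &
    forall x y, x \in I -> y \in J -> `|x - x0| < d -> `|y - y0| < d ->
      `|f x y - f x0 y0 - (A * (x - x0) + B * (y - y0))|
        <= e * (`|x - x0| + `|y - y0|).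

Lemma affine_approx_continuous1 f y : y \in J ->
  (forall x, x \in I -> exists A B, affine_approx f x y A B) ->
  {within [set` I], continuous (fun x => f x y)}.
Proof.
move=> yJ fd; apply/subspace_continuousP => x xI.
have [A [B fA]] := fd x xI.
apply/cvgrPdist_le => e e0.
(* Tolerance 1 with [y] fixed bounds the increment by [(|A| + 1) * |z - x|]. *)
have [d d0 Hd] := fA 1 ltr01.
have A0 : 0 < `|A| + 1 by rewrite ltr_wpDl.
have eA0 : 0 < e / (`|A| + 1) by rewrite divr_gt0.
rewrite near_withinE; near=> z => zI.
have zx : `|z - x| < d.
  by rewrite distrC; near: z; exact: nbhsx_ballx.
have ze : `|z - x| <= e / (`|A| + 1).
  by apply/ltW; rewrite distrC; near: z; exact: nbhsx_ballx.
have := Hd z y zI yJ zx; rewrite !subrr normr0 => /(_ d0).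
rewrite mulr0 !addr0 mul1r => H.
rewrite distrC -(subrK (A * (z - x)) (f z y - f x y)).
rewrite (le_trans (ler_normD _ _)) // normrM.
rewrite (@le_trans _ _ ((`|A| + 1) * `|z - x|)) //; first by lra.
by rewrite mulrC -ler_pdivlMr.
Unshelve. all: by end_near. Qed.

End AffineApproximation.

Lemma affine_approx_swap (R : realType) (I J : interval R) (f : R -> R -> R)
    x y A B :
  affine_approx I J f x y A B -> affine_approx J I (fun y x => f x y) y x B A.
Proof.
move=> H e e0; have [d d0 Hd] := H e e0; exists d => // u v uJ vI ud vd.
by rewrite [X in _ - X]addrC [X in e * X]addrC Hd.
Qed.

Lemma affine_approx_continuous2 (R : realType) (I J : interval R)
    (f : R -> R -> R) x :
  x \in I -> (forall y, y \in J -> exists A B, affine_approx I J f x y A B) ->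
  {within [set` J], continuous (f x)}.
Proof.
move=> xI fd.
apply: (@affine_approx_continuous1 _ J I (fun y x => f x y) x) => // y yJ.
by have [A [B /affine_approx_swap fA]] := fd y yJ; exists B, A.
Qed.

Lemma halves_bounds (R : realDomainType) (l r x u : R) :
  0 <= u -> l <= x -> x + u + u <= r ->
  [/\ l <= x + u, l <= x + u + u, x + u <= r & x <= r].
Proof. by move=> u0 lx xr; split; lra. Qed.

(** * Goursat's theorem on rectangles *)

Section Goursat.
Context {R : realType} (I J : interval R) (f g : R -> R -> R).

(* The shared coefficient [B] says that the 1-form [f dx + g dy] is closed at
   every point; its coefficients need not be continuously differentiable. *)
Definition closed_form : Prop := forall x y, x \in I -> y \in J ->
  exists A B D, affine_approx I J f x y A B /\ affine_approx I J g x y B D.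

(** For [x <= x'] and [y <= y'], the integral of [f dx + g dy] clockwise around the rectangle. *)
Definition circulation x x' y y' :=
  (oriented_integral (f^~ y') x x' - oriented_integral (f^~ y) x x')
  - (oriented_integral (g x') y y' - oriented_integral (g x) y y').

Context (fg : closed_form).

Let cf y : y \in J -> {within [set` I], continuous (fun x => f x y)}.
Proof.
move=> yJ; apply: (affine_approx_continuous1 _ _ _ _ yJ) => x xI.
by have [A [B [D [? _]]]] := fg x y xI yJ; exists A, B.
Qed.

Let cg x : x \in I -> {within [set` J], continuous (g x)}.
Proof.
move=> xI; apply: (affine_approx_continuous2 _ _ _ _ _ xI) => y yJ.
by have [A [B [D [_ ?]]]] := fg x y xI yJ; exists B, D.
Qed.

(** The difference of the [f] integrals and that of the [g] integrals are both close to the same [B]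
    times the area. These terms cancel and leave errors quadratic in the side lengths. *)
Lemma circulation_local x0 y0 (e : R) : x0 \in I -> y0 \in J -> 0 < e ->
  exists2 d : R, 0 < d &
    forall x x' y y', x \in I -> x' \in I -> y \in J -> y' \in J ->
    x <= x0 <= x' -> y <= y0 <= y' -> x' - x < d -> y' - y < d ->
    `|circulation x x' y y'| <= e * (x' - x + (y' - y)) ^+ 2.
Proof.
move=> x0I y0J e0; have [A [B [D [fA gA]]]] := fg x0 y0 x0I y0J.
have e20 : 0 < e / 2 by rewrite divr_gt0.
have [d1 d10 fd] := fA _ e20; have [d2 d20 gd] := gA _ e20.
exists (Num.min d1 d2); first by rewrite lt_min d10.
move=> x x' y y' xI x'I yJ y'J /andP[xx0 x0x'] /andP[yy0 y0y'].
rewrite !lt_min => /andP[xd1 xd2] /andP[yd1 yd2].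
have xx' : x <= x' by exact: le_trans x0x'.
have yy' : y <= y' by exact: le_trans y0y'.
have Hf : `|oriented_integral (f^~ y') x x' - oriented_integral (f^~ y) x x'
     - B * (y' - y) * (x' - x)| <= e * (x' - x + (y' - y)) * `|x' - x|.
  apply: (oriented_integralB_bound I) => //; [exact: cf|exact: cf|].
  move=> z zI; rewrite [`|x' - x|]ger0_norm ?subr_ge0 // => zx zx'.
  have {zx zx'}zx0 : `|z - x0| <= x' - x by move: zx zx'; rewrite !ler_norml; lra.
  have near_y t : t \in J -> `|t - y0| <= y' - y ->
      `|f z t - f x0 y0 - (A * (z - x0) + B * (t - y0))| <= e / 2 * (x' - x + (y' - y)).
    move=> tJ ty0.
    apply: le_trans (fd z t zI tJ (le_lt_trans zx0 xd1) (le_lt_trans ty0 yd1)) _.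
    by rewrite ler_wpM2l ?lerD // ltW.
  (* Subtracting the approximations at [y'] and [y] cancels the [A] terms and leaves [B * (y' - y)];
     the two errors of [e / 2] add up to [e]. *)
  have := near_y _ y'J; have := near_y _ yJ; rewrite !ler_norml; lra.
have Hg : `|oriented_integral (g x') y y' - oriented_integral (g x) y y'
     - B * (x' - x) * (y' - y)| <= e * (x' - x + (y' - y)) * `|y' - y|.
  apply: (oriented_integralB_bound J) => //; [exact: cg|exact: cg|].
  move=> z zJ; rewrite [`|y' - y|]ger0_norm ?subr_ge0 // => zy zy'.
  have {zy zy'}zy0 : `|z - y0| <= y' - y by move: zy zy'; rewrite !ler_norml; lra.
  have near_x t : t \in I -> `|t - x0| <= x' - x ->
      `|g t z - g x0 y0 - (B * (t - x0) + D * (z - y0))| <= e / 2 * (x' - x + (y' - y)).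
    move=> tI tx0.
    apply: le_trans (gd t z tI zJ (le_lt_trans tx0 xd2) (le_lt_trans zy0 yd2)) _.
    by rewrite ler_wpM2l ?lerD // ltW.
  have := near_x _ x'I; have := near_x _ xI; rewrite !ler_norml; lra.
move: Hf Hg; rewrite [`|x' - x|]ger0_norm ?subr_ge0 //.
rewrite [`|y' - y|]ger0_norm ?subr_ge0 // => Hf Hg.
rewrite (_ : circulation x x' y y' =
    (oriented_integral (f^~ y') x x' - oriented_integral (f^~ y) x x'
       - B * (y' - y) * (x' - x))
    - (oriented_integral (g x') y y' - oriented_integral (g x) y y'
       - B * (x' - x) * (y' - y))); last by rewrite /circulation; ring.
rewrite (le_trans (ler_normB _ _)) //.
rewrite (le_trans (lerD Hf Hg)) // le_eqVlt; apply/orP; left; apply/eqP; ring.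
Qed.

(** Each inner edge is traversed twice in opposite directions; only the outer edges have to be split
    at their midpoints. *)
Lemma circulation_quarters x w y h : x \in I -> x + w \in I -> x + w + w \in I ->
  y \in J -> y + h \in J -> y + h + h \in J ->
  circulation x (x + w + w) y (y + h + h) =
    circulation x (x + w) y (y + h) + circulation (x + w) (x + w + w) y (y + h)
    + (circulation x (x + w) (y + h) (y + h + h)
       + circulation (x + w) (x + w + w) (y + h) (y + h + h)).
Proof.
move=> x0 x1 x2 y0 y1 y2; rewrite /circulation.
rewrite -(oriented_integralD _ _ x (x + w) (x + w + w) (cf _ y0)) //.
rewrite -(oriented_integralD _ _ x (x + w) (x + w + w) (cf _ y2)) //.
rewrite -(oriented_integralD _ _ y (y + h) (y + h + h) (cg _ x0)) //.
rewrite -(oriented_integralD _ _ y (y + h) (y + h + h) (cg _ x2)) //.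
ring.
Qed.

(** The bound is proportional to the squared half perimeter, so each quarter is allowed exactly a
    quarter of it and the four allowances add up. Bisection then reduces the claim to
    [circulation_local]. *)
Lemma circulation_bound (a w b h e : R) : 0 < e -> 0 <= w -> 0 <= h ->
  a \in I -> a + w \in I -> b \in J -> b + h \in J ->
  `|circulation a (a + w) b (b + h)| <= e * (w + h) ^+ 2.
Proof.
move=> e0 w0 h0 aI awI bJ bhJ.
have wn0 n : 0 <= w / 2 ^+ n by rewrite divr_ge0 // exprn_ge0.
have hn0 n : 0 <= h / 2 ^+ n by rewrite divr_ge0 // exprn_ge0.
have inI := subset_itvcc _ _ _ aI awI.
have inJ := subset_itvcc _ _ _ bJ bhJ.
(* Confining the rectangle to the initial one keeps its corners in [I] and [J]. *)
pose P x y n := a <= x -> x + w / 2 ^+ n <= a + w ->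
  b <= y -> y + h / 2 ^+ n <= b + h ->
  `|circulation x (x + w / 2 ^+ n) y (y + h / 2 ^+ n)|
    <= e * (w / 2 ^+ n + h / 2 ^+ n) ^+ 2.
suff : P a b 0%N by rewrite /P expr0 !divr1 !lexx; apply.
apply: (rectangle_bisection P a b w h) => //.
  move=> x y n; rewrite /P (half_half w n) (half_half h n).
  move: (w / 2 ^+ n.+1) (h / 2 ^+ n.+1) (wn0 n.+1) (hn0 n.+1) => u v u0 v0.
  rewrite !addrA => P1 P2 P3 P4 ax xa yb yb'.
  have [axu axu' xua xa'] := halves_bounds _ _ _ _ _ u0 ax xa.
  have [byv byv' yvb yb''] := halves_bounds _ _ _ _ _ v0 yb yb'.
  rewrite circulation_quarters; first last.
  all: try by [apply: inI; rewrite /= in_itv /= ?axu ?ax ?axu' |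
               apply: inJ; rewrite /= in_itv /= ?byv ?yb ?byv'].
  have {}P1 := P1 ax xua yb yvb.
  have {}P2 := P2 axu xa yb yvb.
  have {}P3 := P3 ax xua byv yb'.
  have {}P4 := P4 axu xa byv yb'.
  apply: le_trans (le_trans (ler_normD _ _) (lerD (ler_normD _ _) (ler_normD _ _))) _.
  apply: le_trans (lerD (lerD P1 P2) (lerD P3 P4)) _.
  by rewrite le_eqVlt; apply/orP; left; apply/eqP; ring.
move=> x0 y0 x0ab y0ab.
have x0I : x0 \in I by apply: inI; rewrite /= in_itv.
have y0J : y0 \in J by apply: inJ; rewrite /= in_itv.
have [d d0 Hd] := circulation_local x0 y0 e x0I y0J e0.
have small v : exists N, forall n, (N <= n)%N -> v / 2 ^+ n < d.
  exists (Num.bound (v / d)) => n Nn.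
  rewrite ltr_pdivrMr ?exprn_gt0 // mulrC -ltr_pdivrMr //.
  exact: upper_nthrootP.
have [N1 N1P] := small w; have [N2 N2P] := small h.
exists (maxn N1 N2) => x y; set n := maxn _ _ => xx0 yy0 ax xa yb yb'.
have := wn0 n; have := hn0 n => hn wn.
have := Hd x (x + w / 2 ^+ n) y (y + h / 2 ^+ n).
have -> (u v : R) : u + v - u = v by ring.
have -> (u v : R) : u + v - u = v by ring.
apply => //.
- by apply: inI; rewrite /= in_itv /=; lra.
- by apply: inI; rewrite /= in_itv /=; lra.
- by apply: inJ; rewrite /= in_itv /=; lra.
- by apply: inJ; rewrite /= in_itv /=; lra.
- by apply: N1P; rewrite leq_maxl.
- by apply: N2P; rewrite leq_maxr.
Qed.

(** For sorted corners the circulation is smaller than every positive number, hence 0; exchanging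
    [a, a'] or [b, b'] only changes its sign. *)
Lemma goursat_rectangle a a' b b' : a \in I -> a' \in I -> b \in J -> b' \in J ->
  oriented_integral (f^~ b') a a' - oriented_integral (f^~ b) a a' =
  oriented_integral (g a') b b' - oriented_integral (g a) b b'.
Proof.
have circulation0 x x' y y' : x \in I -> x' \in I -> y \in J -> y' \in J ->
    x <= x' -> y <= y' -> circulation x x' y y' = 0.
  move=> xI x'I yJ y'J xx' yy'; apply/eqP; rewrite -normr_le0.
  apply/ler_addgt0Pl => e e0; rewrite addr0.
  (* The added 1 keeps the denominator positive when the rectangle is a single point. *)
  have k0 : 0 < (x' - x + (y' - y)) ^+ 2 + 1 by rewrite ltr_wpDl // sqr_ge0.
  have := circulation_bound x (x' - x) y (y' - y) _ (divr_gt0 e0 k0).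
  rewrite !subr_ge0 (addrC x (_ - _)) (addrC y (_ - _)) !subrK.
  move=> /(_ xx' yy' xI x'I yJ y'J).
  move=> /le_trans; apply; rewrite mulrAC ler_pdivrMr // ler_wpM2l ?ltW //.
  by rewrite addrC ltrDl.
have circulationC1 x x' y y' : circulation x' x y y' = - circulation x x' y y'.
  rewrite /circulation (oriented_integralN (f^~ y') x' x).
  rewrite (oriented_integralN (f^~ y) x' x).
  by ring.
have circulationC2 x x' y y' : circulation x x' y' y = - circulation x x' y y'.
  rewrite /circulation (oriented_integralN (g x') y' y) (oriented_integralN (g x) y' y).
  by ring.
move=> aI a'I bJ b'J; apply/eqP; rewrite -subr_eq0; apply/eqP.
rewrite -/(circulation a a' b b').
have [aa'|/ltW a'a] := leP a a'; have [bb'|/ltW b'b] := leP b b'.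
- exact: circulation0.
- by rewrite circulationC2 circulation0 // oppr0.
- by rewrite circulationC1 circulation0 // oppr0.
- by rewrite circulationC1 circulationC2 circulation0 // !oppr0.
Qed.

End Goursat.

(** * Derivatives within a set *)

Definition frechet_within {R : realType} {V W : normedModType R} (T : set V)
    (f : V -> W) (x : V) (L : {linear V -> W}) : Prop :=
  forall e : R, 0 < e -> exists2 d : R, 0 < d & forall y, T y -> `|y - x| < d ->
    `|f y - f x - L (y - x)| <= e * `|y - x|.

(** Differentiability along a filter expands [f] about the [lim] of the filter; since [T x], the
    filter is proper and that limit is [x]. *)
Lemma differentiable_within_frechet (R : realType) (V W : normedModType R)
    (T : set V) (f : V -> W) (x : V) : T x ->
  differentiable f (within T (nbhs x)) -> exists L, frechet_within T f x L.
Proof.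
move=> Tx; case=> -[_ dfx].
have pF : ProperFilter (within T (nbhs x)).
  by apply: Build_ProperFilter_ex => P /= /nbhs_singleton /(_ Tx) Px; exists x.
have limE : lim (within T (nbhs x)) = x.
  apply: norm_cvg_lim.
  exact: cvg_within.
move: dfx; move: (diff _ _) => L dfx.
exists L => e e0.
move/eqaddoP : dfx => /(_ e e0).
set z := lim _; have -> : z = x by exact: limE.
move=> /nbhs_ballP[d /= d0 H].
exists d => // y Ty yd.
have := H y; rewrite -ball_normE /= distrC => /(_ yd Ty).
by rewrite !fctE /= opprD addrA.
Qed.

(** * Moving one coordinate inside a rectangle *)

Section Coordinates.
Context {R : realType} {p : nat}.
Implicit Types (I : 'I_p -> interval R) (theta c : 'rV[R]_p) (t u : 'I_p).

Lemma set_coord_rectangle I t z theta : rectangle I theta -> z \in I t ->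
  rectangle I (set_coord t z theta).
Proof.
by move=> thI zI i; rewrite mxE; case: eqP => [->|_].
Qed.

Lemma set_coordE t z theta : set_coord t z theta = theta + (z - theta 0 t) *: 'e_t.
Proof.
apply/rowP => j; rewrite !mxE eqxx /=; case: eqVneq => [->|_].
  by rewrite mulr1 addrC subrK.
by rewrite mulr0 addr0.
Qed.

(** Properness makes limits along the filter unique. Some [b] in the side differs from [theta 0 u],
    and short steps towards [b] stay in the rectangle by convexity. *)
Lemma partial_quotient_filter_proper I u theta : nondegenerate_sides I ->
  rectangle I theta -> ProperFilter (partial_quotient_filter (rectangle I) u theta).
Proof.
move=> hI thI; apply: Build_ProperFilter => //.
move=> /nbhs_ballP[d /= d0 H].
have [b bI bth] : exists2 b, b \in I u & b != theta 0 u.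
  have [a [b [aI bI ab]]] := hI u.
  have [ath|] := eqVneq a (theta 0 u); last by exists a.
  by exists b => //; rewrite -ath gt_eqF.
have b0 : 0 < `|b - theta 0 u| by rewrite normr_gt0 subr_eq0.
(* This fraction of the way to [b] does not pass [b] and has length at most [d / 2]. *)
pose s := Num.min 1 (d / 2 / `|b - theta 0 u|).
have s0 : 0 < s by rewrite lt_min ltr01 !divr_gt0.
have s1 : s <= 1 by rewrite ge_min lexx.
apply: (H (s * (b - theta 0 u))).
- rewrite /ball /= sub0r normrN normrM gtr0_norm //.
  have : s * `|b - theta 0 u| <= d / 2 by rewrite -ler_pdivlMr // ge_min lexx orbT.
  by move=> /le_lt_trans; apply; rewrite ltr_pdivrMr // ltr_pMr // ltr1n.
- by apply: mulf_neq0; [rewrite gt_eqF | rewrite subr_eq0].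
- rewrite /= (_ : theta + _ =
      set_coord u (theta 0 u + s * (b - theta 0 u)) theta); last first.
    by rewrite set_coordE addrAC subrr add0r.
  apply: set_coord_rectangle => //.
  have thu := thI u.
  have [thb|/ltW bth'] := leP (theta 0 u) b.
    apply: (subset_itvcc _ _ _ thu bI); rewrite /= in_itv /=.
    by apply/andP; split; nra.
  apply: (subset_itvcc _ _ _ bI thu); rewrite /= in_itv /=.
  by apply/andP; split; nra.
Qed.

End Coordinates.

(** * Partial derivatives, and restrictions to coordinate lines and planes *)

Section Partial.
Context {R : realType} {p : nat}.
Implicit Types (T : set 'rV[R]_p) (I : 'I_p -> interval R).
Implicit Types (theta : 'rV[R]_p) (t u s : 'I_p).

Lemma is_partial_le T u (f : 'rV[R]_p -> R) (x : 'rV[R]_p) (l : R) :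
  (forall e : R, 0 < e -> exists2 d : R, 0 < d & forall h, `|h| < d ->
     T (x + h *: 'e_u) -> `|f (x + h *: 'e_u) - f x - l * h| <= e * `|h|) ->
  is_partial T u f x l.
Proof.
move=> H; apply/cvgrPdist_le => e e0; have [d d0 Hd] := H e e0.
apply/nbhs_ballP; exists d => // h; rewrite /ball /= sub0r normrN => hd h0 Th.
rewrite distrC (_ : _ - l = h^-1 * (f (x + h *: 'e_u) - f x - l * h)); last first.
  by field.
by rewrite normrM normfV ler_pdivrMl ?normr_gt0 // [leRHS]mulrC Hd.
Qed.

Lemma is_partial_partial I u (f : 'rV[R]_p -> R) theta l :
  nondegenerate_sides I -> rectangle I theta ->
  is_partial (rectangle I) u f theta l -> partial (rectangle I) u f theta = l.
Proof.
move=> hI thI fl.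
have := partial_quotient_filter_proper I u theta hI thI => FF.
exact: (cvg_lim _ fl).
Qed.

Lemma normr_coord_le theta t : `|theta 0 t| <= `|theta|.
Proof.
rewrite [leRHS]mx_normrE.
exact: (le_bigmax _ (fun ij : 'I_1 * 'I_p => `|theta ij.1 ij.2|) (0, t)).
Qed.

Lemma normr_basis_le1 t : `|'e_t : 'rV[R]_p| <= 1.
Proof.
rewrite [leLHS]mx_normrE; apply: bigmax_le => // -[i j] _ /=.
by rewrite mxE; case: andP => _; rewrite ?normr1 ?normr0.
Qed.

Lemma frechet_is_partial I u s (phi : 'rV[R]_p -> 'rV[R]_p) theta
    (L : {linear 'rV[R]_p -> 'rV[R]_p}) :
  frechet_within (rectangle I) phi theta L ->
  is_partial (rectangle I) u (fun y => phi y 0 s) theta (L 'e_u 0 s).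
Proof.
move=> phiL; apply: is_partial_le => e e0; have [d d0 Hd] := phiL e e0.
exists d => // h hd Th.
have hh : `|h *: ('e_u : 'rV[R]_p)| <= `|h|.
  by rewrite normrZ ler_piMr // normr_basis_le1.
have := Hd _ Th; rewrite [_ + _ - _]addrAC subrr add0r linearZ /=.
move=> /(_ (le_lt_trans hh hd)) H.
rewrite (_ : _ - _ = (phi (theta + h *: 'e_u) - phi theta - h *: L 'e_u) 0 s).
  by rewrite (le_trans (normr_coord_le _ _)) // (le_trans H) // ler_wpM2l // ltW.
by rewrite !mxE; ring.
Qed.

Lemma frechet_affine_approx I t u s (phi : 'rV[R]_p -> 'rV[R]_p) eta (x0 y0 : R)
    (L : {linear 'rV[R]_p -> 'rV[R]_p}) :
  t != u -> rectangle I eta ->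
  frechet_within (rectangle I) phi (set_coord t x0 (set_coord u y0 eta)) L ->
  affine_approx (I t) (I u) (fun x y => phi (set_coord t x (set_coord u y eta)) 0 s)
    x0 y0 (L 'e_t 0 s) (L 'e_u 0 s).
Proof.
move=> tu etaI phiL e e0; have [d d0 Hd] := phiL e e0.
(* Halved because the displacement is bounded by the sum of two coordinate increments. *)
exists (d / 2); first by rewrite divr_gt0.
move=> x y xI yI xx0 yy0; set q := set_coord t x _; set q0 := set_coord t x0 _.
have qE : q - q0 = (x - x0) *: 'e_t + (y - y0) *: 'e_u.
  apply/rowP => j; rewrite !mxE eqxx /=.
  have [->|jt] := eqVneq j t; first by rewrite (negPf tu) /=; ring.
  by have [_|_] := eqVneq j u; rewrite /=; ring.
have qI : rectangle I q by do 2! apply: set_coord_rectangle => //.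
have qn : `|q - q0| <= `|x - x0| + `|y - y0|.
  rewrite qE (le_trans (ler_normD _ _)) // !normrZ.
  by rewrite lerD // ler_piMr // normr_basis_le1.
have := Hd _ qI (le_lt_trans qn _).
rewrite (_ : `|x - x0| + `|y - y0| < d); last by lra.
move=> /(_ isT) H.
rewrite (_ : _ - _ - _ = (phi q - phi q0 - L (q - q0)) 0 s).
  rewrite (le_trans (normr_coord_le _ _)) // (le_trans H) // ler_wpM2l //.
  exact: ltW.
by rewrite qE [in RHS]linearD [in RHS]linearZ [in RHS]linearZ /= !mxE; ring.
Qed.

Lemma frechet_continuous_coord I u s (phi : 'rV[R]_p -> 'rV[R]_p) eta :
  rectangle I eta ->
  (forall theta, rectangle I theta ->
     exists L, frechet_within (rectangle I) phi theta L) ->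
  {within [set` I u], continuous (fun w => phi (set_coord u w eta) 0 s)}.
Proof.
move=> etaI dphi.
(* The two-variable lemma is applied with a dummy second variable of slope 0. *)
apply: (affine_approx_continuous1 (I u) (I u) (fun w _ => phi (set_coord u w eta) 0 s)
  _ (etaI u)).
move=> w0 w0I; have [L phiL] := dphi _ (set_coord_rectangle _ _ _ _ etaI w0I).
exists (L 'e_u 0 s), 0 => e e0; have [d d0 Hd] := phiL e e0.
exists d => // w y wI _ wd _.
have qE : set_coord u w eta - set_coord u w0 eta = (w - w0) *: 'e_u.
  apply/rowP => j; rewrite !mxE eqxx /=.
  by have [_|_] := eqVneq j u => /=; ring.
have qn : `|set_coord u w eta - set_coord u w0 eta| <= `|w - w0|.
  by rewrite qE normrZ ler_piMr // normr_basis_le1.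
have H := Hd _ (set_coord_rectangle _ _ _ _ etaI wI) (le_lt_trans qn wd).
rewrite mul0r addr0 (_ : _ - _ - _ =
  (phi (set_coord u w eta) - phi (set_coord u w0 eta) - L ((w - w0) *: 'e_u)) 0 s).
  rewrite (le_trans (normr_coord_le _ _)) // -qE (le_trans H) // ler_wpM2l //.
    exact: ltW.
  by rewrite (le_trans qn) // lerDl.
by rewrite [in RHS]linearZ /= !mxE; ring.
Qed.

End Partial.

(** * Increments of the potential [ln pi_tilde] *)

Section Potential.
Context {R : realType} {p : nat} (I : 'I_p -> interval R)
  (phi : 'rV[R]_p -> 'rV[R]_p) (c : 'rV[R]_p).
Implicit Types (theta eta : 'rV[R]_p) (t u s : 'I_p).

(** Leads from [theta] at [k = 0] to [c] at [k = p]; [psi phi c t] is component [t] of [phi] at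
    [anchor t]. *)
Definition anchor (k : nat) theta : 'rV[R]_p :=
  \row_j (if (j < k)%N then c 0 j else theta 0 j).

Definition psi_integral t theta : R :=
  oriented_integral (fun z => psi phi c t (set_coord t z theta))
    (c 0 t) (theta 0 t).

(** The terms of the telescoping sum: for [k < u], the indices [k] and [k.+1] give opposite edges of
    one rectangle. *)
Definition edge u theta (y : R) (k : nat) : R :=
  oriented_integral (fun w => phi (set_coord u w (anchor k theta)) 0 u)
    (theta 0 u) y.

Context (symmetric_diff : forall theta, rectangle I theta ->
  exists2 L, frechet_within (rectangle I) phi theta L &
    forall t u, L 'e_u 0 t = L 'e_t 0 u).
Context (cI : rectangle I c).

Let phi_continuous u s eta : rectangle I eta ->
  {within [set` I u], continuous (fun w => phi (set_coord u w eta) 0 s)}.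
Proof.
move=> etaI; apply: frechet_continuous_coord => // theta thI.
by have [L ? _] := symmetric_diff theta thI; exists L.
Qed.

(** Symmetry of [L] makes the [y]-derivative of the first function equal to the [x]-derivative of
    the second, which is the shared coefficient. *)
Let phi_closed t u eta : t != u -> rectangle I eta ->
  closed_form (I t) (I u)
    (fun x y => phi (set_coord t x (set_coord u y eta)) 0 t)
    (fun x y => phi (set_coord t x (set_coord u y eta)) 0 u).
Proof.
move=> tu etaI x y xI yI.
have [L phiL Lsym] : exists2 L,
    frechet_within (rectangle I) phi (set_coord t x (set_coord u y eta)) L &
    forall t u, L 'e_u 0 t = L 'e_t 0 u.
  by apply: symmetric_diff; do 2! apply: set_coord_rectangle => //.
exists (L 'e_t 0 t), (L 'e_u 0 t), (L 'e_u 0 u); split.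
  exact: frechet_affine_approx.
by rewrite Lsym; exact: frechet_affine_approx.
Qed.

Let anchor_rectangle k theta : rectangle I theta -> rectangle I (anchor k theta).
Proof. by move=> thI i; rewrite mxE; case: ifP. Qed.

(* Goursat's theorem on the rectangle [c_t, theta_t] x [theta_u, y]. *)
Lemma psi_integral_before t u theta (y : R) : (t < u)%N ->
  rectangle I theta -> y \in I u ->
  psi_integral t (set_coord u y theta) - psi_integral t theta =
  edge u theta y t - edge u theta y t.+1.
Proof.
move=> tu thI yI; have tNu : t != u by rewrite neq_ltn tu.
have utF : (u < t)%N = false by rewrite ltnNge ltnW.
have := goursat_rectangle _ _ _ _ (phi_closed t u (anchor t theta) tNu
  (anchor_rectangle t theta thI)) _ _ _ _ (cI t) (thI t) (thI u) yI.
rewrite /psi_integral /edge /psi.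
congr (_ - _ = _ - _).
- rewrite mxE (negPf tNu); congr oriented_integral; apply/funext => z.
  congr (phi _ 0 t); apply/rowP => j; rewrite !mxE.
  have [->|jt] := eqVneq j t; first by rewrite ltnn.
  by have [->|ju] := eqVneq j u; rewrite ?utF.
- congr oriented_integral; apply/funext => z.
  congr (phi _ 0 t); apply/rowP => j; rewrite !mxE.
  have [->|jt] := eqVneq j t; first by rewrite ltnn.
  by have [->|ju] := eqVneq j u; rewrite ?utF.
- congr oriented_integral; apply/funext => z.
  congr (phi _ 0 u); apply/rowP => j; rewrite !mxE.
  have [->|jt] := eqVneq j t; first by rewrite (negPf tNu) ltnn.
  by [].
- congr oriented_integral; apply/funext => z.
  congr (phi _ 0 u); apply/rowP => j; rewrite !mxE.
  have [->|jt] := eqVneq j t; first by rewrite (negPf tNu) ltnSn.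
  by rewrite [(j < t.+1)%N]ltnS [(j <= t)%N]leq_eqVlt (negPf (jt : (j : nat) != t)).
Qed.

(** The integrand overwrites coordinate [u], so moving [theta 0 u] only moves the upper limit of
    integration. *)
Lemma psi_integral_self u theta (y : R) : rectangle I theta -> y \in I u ->
  psi_integral u (set_coord u y theta) - psi_integral u theta = edge u theta y u.
Proof.
move=> thI yI.
have psiE eta : (forall j : 'I_p, j != u -> eta 0 j = theta 0 j) ->
    (fun z => psi phi c u (set_coord u z eta)) =
    (fun w => phi (set_coord u w (anchor u theta)) 0 u).
  move=> etaE; apply/funext => z; congr (phi _ 0 u); apply/rowP => j; rewrite !mxE.
  by have [->|ju] := eqVneq j u; [rewrite ltnn | rewrite etaE].
rewrite /psi_integral /edge !psiE; first last.
- by move=> j ju; rewrite mxE (negPf ju).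
- by [].
have ca := phi_continuous u u _ (anchor_rectangle u theta thI).
rewrite mxE eqxx -(oriented_integralD (I u) _ (c 0 u) (theta 0 u) y ca) //.
by rewrite addrAC subrr add0r.
Qed.

Lemma psi_integral_after t u theta (y : R) : (u < t)%N ->
  psi_integral t (set_coord u y theta) = psi_integral t theta.
Proof.
move=> ut; have tNu : t != u by rewrite neq_ltn ut orbT.
rewrite /psi_integral /psi mxE (negPf tNu); congr oriented_integral.
apply/funext => z; congr (phi _ 0 t); apply/rowP => j; rewrite !mxE.
by have [->|jt] := eqVneq j u; rewrite ?ut //.
Qed.

Lemma psi_integral_increment u theta (y : R) : rectangle I theta -> y \in I u ->
  \sum_(t < p) psi_integral t (set_coord u y theta)
    - \sum_(t < p) psi_integral t theta =
  oriented_integral (fun w => phi (set_coord u w theta) 0 u) (theta 0 u) y.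
Proof.
move=> thI yI; rewrite -sumrB.
(* The value 0 beyond [u] lets one formula cover every [t]: at [t = u] the term [G t.+1] vanishes,
   and for [t > u] both terms do. *)
pose G k := if (k <= u)%N then edge u theta y k else 0.
have incrE t : psi_integral t (set_coord u y theta) - psi_integral t theta =
    - (G t.+1 - G t).
  rewrite opprB /G; have [tu|ut|tu] := ltngtP t u.
  - exact: psi_integral_before.
  - by rewrite psi_integral_after // !subrr.
  - have -> : t = u by exact: val_inj.
    by rewrite psi_integral_self // subr0.
under eq_bigr do rewrite incrE.
(* The sum is [G 0 - G p], where [G p = 0] because [u < p], and [anchor 0 theta] is [theta]. *)
rewrite sumrN -(big_mkord predT (fun k => G k.+1 - G k)) telescope_sumr //.
rewrite opprB /G leq0n [(p <= u)%N]leqNgt ltn_ord subr0 /edge.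
by congr oriented_integral; apply/funext => w; congr (phi (set_coord _ _ _) 0 u);
   apply/rowP => j; rewrite mxE.
Qed.

Lemma ln_pi_tilde theta : ln (pi_tilde phi c theta) = \sum_(t < p) psi_integral t theta.
Proof. exact: expRK. Qed.

(** The fundamental theorem of calculus: the increment is an integral of component [u] of [phi],
    which on a short segment stays within [e] of its value at [theta]. *)
Lemma is_partial_ln_pi_tilde u theta : rectangle I theta ->
  is_partial (rectangle I) u (fun y => ln (pi_tilde phi c y)) theta (phi theta 0 u).
Proof.
move=> thI; apply: is_partial_le => e e0.
have stepE h : theta + h *: 'e_u = set_coord u (theta 0 u + h) theta.
  by rewrite set_coordE addrAC subrr add0r.
have thE : set_coord u (theta 0 u) theta = theta.
  by rewrite set_coordE subrr scale0r addr0.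
have /subspace_continuousP/(_ _ (thI u))/cvgrPdist_le/(_ e e0) :=
  phi_continuous u u theta thI.
move=> /nbhs_ballP[d /= d0 Hd]; exists d => // h hd Th.
have yI : theta 0 u + h \in I u.
  by have := Th u; rewrite stepE mxE eqxx.
rewrite !ln_pi_tilde stepE (psi_integral_increment u theta _ thI yI).
have zero_int a b : oriented_integral (cst 0 : R -> R) a b = 0.
  rewrite /oriented_integral !Rintegral_cst // !mul0r oppr0.
  by case: ifP.
have := oriented_integralB_bound (I u) (fun w => phi (set_coord u w theta) 0 u) (cst 0)
  (theta 0 u) (theta 0 u + h) (phi theta 0 u) e (phi_continuous u u theta thI)
  (continuous_subspaceT (@cst_continuous _ _ 0)) (thI u) yI.
rewrite zero_int subr0 [_ + h - _]addrAC subrr add0r; apply => z zI zh _.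
rewrite /= subr0 distrC -[X in phi X 0 u]thE; apply: Hd => //.
by rewrite -ball_normE /= distrC (le_lt_trans zh).
Qed.

End Potential.

Theorem corollary3 (R : realType) (p : nat) (I : 'I_p -> interval R)
    (phi : 'rV[R]_p -> 'rV[R]_p) (c : 'rV[R]_p) (pi : 'rV[R]_p -> R)
    (hI : nondegenerate_sides I)
    (hdiff : forall theta, rectangle I theta ->
       differentiable phi (within (rectangle I) (nbhs theta)))
    (hinter : integral_partial_interchange I phi)
    (hsym : forall theta, rectangle I theta -> forall t u : 'I_p,
       partial (rectangle I) u (fun y => phi y 0 t) theta =
       partial (rectangle I) t (fun y => phi y 0 u) theta)
    (hc : rectangle I c)
    (hpi : prior (rectangle I) pi)
    (hprop : proportional_on (rectangle I) pi (pi_tilde phi c)) :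
  forall theta, rectangle I theta -> forall u : 'I_p,
    is_partial (rectangle I) u (fun y => ln (pi y)) theta (phi theta 0 u).
Proof.
move=> theta thI u; have [k k0 piE] := hprop.
have symmetric_diff eta : rectangle I eta ->
    exists2 L, frechet_within (rectangle I) phi eta L &
      forall t u, L 'e_u 0 t = L 'e_t 0 u.
  move=> etaI.
  have [L phiL] := differentiable_within_frechet _ _ _ _ _ _ etaI (hdiff eta etaI).
  exists L => // s t.
  (* By uniqueness of limits the partial derivatives are the entries of [L], so [hsym] becomes the
     symmetry of [L]. *)
  have partialE i j := is_partial_partial I i _ eta _ hI etaI
    (frechet_is_partial I i j phi eta L phiL).
  by rewrite -!partialE hsym.
have lnE y : rectangle I y -> ln (pi y) = ln k + ln (pi_tilde phi c y).
  by move=> yI; rewrite piE // lnM ?posrE ?expR_gt0.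
have := is_partial_ln_pi_tilde I phi c symmetric_diff hc u theta thI.
(* Increments in the filter stay in the rectangle, where [ln pi] and [ln pi_tilde] differ by the
   constant [ln k]; the quotients agree there, so any radius serves. *)
apply: cvg_trans; apply: near_eq_cvg; apply/nbhs_ballP; exists 1 => //= h _ _ Th.
rewrite (lnE _ Th) (lnE _ thI).
have addlKB (r l a b : R) : r * (a - b) = r * (l + a - (l + b)) by ring.
exact: addlKB.
Qed.
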